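(* Let $n\geq 1$. Every abelian subgroup $G\subseteq\mathcal S_n$ is non-nudgable.
   Context: $\mathcal S_n$ denotes the group of all permutations of $\{1,\ldots,n\}$. For $\sigma\in\mathcal S_n$ the inversion set is $\mathrm{inv}(\sigma)=\{(i,j)\mid 1\leq i<j\leq n,\ \sigma(j)<\sigma(i)\}$. For a subgroup $G\subseteq\mathcal S_n$ and $\pi\in G$ put $D_G(\pi)=\{\sigma\in G\mid \mathrm{inv}(\sigma)\cap\mathrm{inv}(\pi)=\emptyset\}$. The subgroup $G\subseteq\mathcal S_n$ is called non-nudgable if $|D_G(\pi)|=|D_G(\pi^{-1})|$ for all $\pi\in G$; otherwise it is called nudgable. *)

(* Defs.v *)
From mathcomp Require Import all_boot all_fingroup.

Set Implicit Arguments.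
Unset Strict Implicit.
Unset Printing Implicit Defensive.

(* Permutations act on {0, ..., n-1} instead of {1, ..., n}. *)
Definition inv_set (n : nat) (s : 'S_n) : {set 'I_n * 'I_n} :=
  [set p : 'I_n * 'I_n | (p.1 < p.2) && (s p.2 < s p.1)].

Definition inv_disjoint_set (n : nat) (G : {group 'S_n}) (pi : 'S_n) :
    {set 'S_n} :=
  [set s in G | inv_set s :&: inv_set pi == set0].

Definition non_nudgable (n : nat) (G : {group 'S_n}) : Prop :=
  forall pi : 'S_n, pi \in G ->
    #|inv_disjoint_set G pi| = #|inv_disjoint_set G pi^-1%g|.

(* Main.v *)
Require Import Defs.
From mathcomp Require Import all_boot all_fingroup.

(** A pair is an inversion of [s^-1 * t] exactly when [s] and [t] order its
    preimages differently, so with [l] counting inversions,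
    [l (s^-1 * t) = l s + l t - 2 * #|inv_set s :&: inv_set t|].  When [s] and
    [t] commute, [s * t^-1] is the inverse of [s^-1 * t]; since [l] is invariant
    under inversion, [s, t] and [s^-1, t^-1] have the same number of common
    inversions.  Hence [s |-> s^-1] maps [inv_disjoint_set G pi] onto
    [inv_disjoint_set G pi^-1]. *)

Lemma card_inv_setVM n (s t : 'S_n) :
  #|inv_set (s^-1 * t)%g| =
    #|inv_set s :\: inv_set t| + #|inv_set t :\: inv_set s|.
Proof.
(* [A] is the inversion set of [s^-1 * t] pulled back along [f]. *)
pose A := [set p : 'I_n * 'I_n | (s p.1 < s p.2) && (t p.2 < t p.1)].
pose f (p : 'I_n * 'I_n) := (s p.1, s p.2).
pose swap (p : 'I_n * 'I_n) := (p.2, p.1).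
have f_inj : injective f by move=> [a b] [c d] [/perm_inj-> /perm_inj->].
have swap_inj : injective swap by move=> [a b] [c d] [-> ->].
have neq (u : 'S_n) (a b : 'I_n) : a < b -> (u a != u b :> nat).
  by move=> ab; rewrite val_eqE (inj_eq perm_inj) -val_eqE ltn_eqF.
have -> : #|inv_set (s^-1 * t)%g| = #|A|.
  rewrite -(card_preimset (inv_set (s^-1 * t)%g) f_inj); apply: eq_card => -[a b].
  by rewrite !inE /= !permM !permK.
pose L := [set p : 'I_n * 'I_n | p.1 < p.2].
(* Pairs of [A] in increasing order are inversions of [t] only; the others, once swapped, are
   inversions of [s] only. *)
rewrite -(cardsID L A) addnC; congr (_ + _).
  rewrite -(card_preimset (A :\: L) swap_inj); apply: eq_card => -[a b].
  rewrite !inE /=; case: (ltngtP a b) => [ab|ab|/val_inj->]; rewrite ?ltnn ?andbF //=.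
  by rewrite andbC; case: ltngtP (neq t _ _ ab).
apply: eq_card => -[a b]; rewrite !inE /=.
case: (ltnP a b) => [ab|_]; rewrite ?andbF //= andbT.
by case: ltngtP (neq s _ _ ab).
Qed.

Lemma inv_set1 n : inv_set (1 : 'S_n)%g = set0.
Proof. by apply/setP=> -[a b]; rewrite !inE !perm1 /=; case: ltngtP. Qed.

Lemma card_inv_setV n (s : 'S_n) : #|inv_set s^-1%g| = #|inv_set s|.
Proof. by rewrite -[s^-1%g]mulg1 card_inv_setVM inv_set1 setD0 set0D cards0 addn0. Qed.

Lemma card_common_inv_setV n (s t : 'S_n) : commute s t ->
  #|inv_set s^-1%g :&: inv_set t^-1%g| = #|inv_set s :&: inv_set t|.
Proof.
move=> cst.
have eq_len : #|inv_set (s^-1^-1 * t^-1)%g| = #|inv_set (s^-1 * t)%g|.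
  by rewrite -card_inv_setV !invMg !invgK -(commuteV (commute_sym cst)).
move: eq_len; rewrite !card_inv_setVM.
have := cardsID (inv_set t) (inv_set s); have := cardsID (inv_set s) (inv_set t).
have := cardsID (inv_set t^-1%g) (inv_set s^-1%g).
have := cardsID (inv_set s^-1%g) (inv_set t^-1%g).
rewrite !card_inv_setV (setIC (inv_set t)) (setIC (inv_set t^-1%g)).
set x := #|_ :&: _|; set y := #|inv_set s :&: _| => tV sV ts st eq_diff.
(* Both [x + x] and [y + y] become the total number of inversions of [s] and [t] once the same count
   of non-common inversions is added. *)
apply: double_inj; apply/eqP.
rewrite -!addnn -(eqn_add2r (#|inv_set s :\: inv_set t| + #|inv_set t :\: inv_set s|)).
by rewrite -{1}eq_diff (addnACA x) (addnACA y) tV sV ts st.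
Qed.

Theorem theorem3p4 (n : nat) (hn : 1 <= n) (G : {group 'S_n})
  (hG : abelian G) : non_nudgable G.
Proof.
move=> pi piG; rewrite -(card_preimset (inv_disjoint_set G pi^-1%g) (@invg_inj _)).
apply: eq_card => s; rewrite !inE groupV.
have [sG /=|//] := boolP (s \in G).
by rewrite -!cards_eq0 card_common_inv_setV //; apply: (centsP hG).
Qed.
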